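(* Let $k\ge 2$ be an integer. For any $(u,v)\in[0,1]^2$ let $$u=\tfrac ik+\tfrac tk\qquad\text{and}\qquad v=\tfrac jk+\tfrac sk,$$ where $i=\lfloor uk\rfloor$, $j=\lfloor vk\rfloor\in\{0,1,\dots,k\}$, $t=uk-i\in[0,1)$ and $s=vk-j\in[0,1)$. Then $$\mathbb{E}[\widehat{X}_k(u,v)]=uv$$ and $$\mathbb{V}[\widehat{X}_k(u,v)]=\frac{1}{k-1}\Big(u(1-u)-\frac{t(1-t)}{k}\Big)\Big(v(1-v)-\frac{s(1-s)}{k}\Big),$$ where $\mathbb{E}$ and $\mathbb{V}$ denote expected value and variance.
   Context: Fix an integer $k\ge 2$. Let $[k]=\{1,\dots,k\}$, $\delta_k=\{0,\tfrac1k,\dots,\tfrac{k-1}{k},1\}$ and $\Delta_k=\delta_k\times\delta_k$. Let $\mathcal{S}_k$ be the set of all permutations of $[k]$. For $\pi\in\mathcal{S}_k$, let $C_\pi\colon\Delta_k\to[0,1]$ be the discrete copula with mass $\tfrac1k$ in each square $[\tfrac{i-1}{k},\tfrac ik]\times[\tfrac{\pi(i)-1}{k},\tfrac{\pi(i)}{k}]$, $i\in[k]$, and mass $0$ in all other squares of the mesh; that is, $C_\pi(\tfrac ik,\tfrac jk)=\tfrac1k\,|\{m\in[k] : m\le i,\ \pi(m)\le j\}|$ for $i,j\in\{0,1,\dots,k\}$. The (piecewise) bilinear extension (checkerboard copula) $\widehat{C}_\pi\colon[0,1]^2\to[0,1]$ of $C_\pi$ is defined, for $(u,v)\in[0,1]^2$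 with $i=\lfloor uk\rfloor$, $j=\lfloor vk\rfloor$, $t=uk-i$, $s=vk-j$, by $$\widehat{C}_\pi(u,v)=(1-t)(1-s)C_\pi(\tfrac ik,\tfrac jk)+t(1-s)C_\pi(\tfrac{i+1}{k},\tfrac jk)+(1-t)s\,C_\pi(\tfrac ik,\tfrac{j+1}{k})+ts\,C_\pi(\tfrac{i+1}{k},\tfrac{j+1}{k}),$$ where terms involving an index $k+1$ (which occur only with coefficient $0$) are understood to be $0$. The random field $\widehat{X}_k$ over $[0,1]^2$ is given by $\widehat{X}_k(u,v)=\widehat{C}_\pi(u,v)$, where $\pi$ is chosen uniformly at random from $\mathcal{S}_k$ (equivalently, $\widehat{C}_\pi$ is chosen uniformly at random from $\{\widehat{C}_\pi:\pi\in\mathcal{S}_k\}$). *)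

(* Defs.v *)
From HB Require Import structures.
From mathcomp Require Import all_boot all_order all_algebra all_fingroup.
From mathcomp Require Import all_classical all_reals all_analysis.

Set Implicit Arguments.
Unset Strict Implicit.
Unset Printing Implicit Defensive.

Import Order.TTheory GRing.Theory Num.Theory.
Local Open Scope classical_set_scope.
Local Open Scope ring_scope.

Section CheckerboardCopula.
Variables (R : realType) (k : nat).

(* [discrete_copula pi i j] is C_pi(i/k, j/k): the grid points are given by
   their indices, and the element m of 'I_k stands for m.+1 in {1, ..., k}.
   Outside the grid (i > k or j > k) the value is 0, as required by the
   convention on the terms with index k + 1 in [checkerboard]. *)
Definition discrete_copula (pi : 'S_k) (i j : nat) : R :=
  if ((i <= k) && (j <= k))%N
  then k%:R^-1 * #|[set m : 'I_k | ((m.+1 <= i) && ((pi m).+1 <= j))%N]%SET|%:R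
  else 0.

(* [Num.truncn] is the floor, as a natural number, of a nonnegative real. *)
Definition checkerboard (pi : 'S_k) (u v : R) : R :=
  let i := Num.truncn (u * k%:R) in
  let j := Num.truncn (v * k%:R) in
  let t := u * k%:R - i%:R in
  let s := v * k%:R - j%:R in
    (1 - t) * (1 - s) * discrete_copula pi i j
  + t * (1 - s) * discrete_copula pi i.+1 j
  + (1 - t) * s * discrete_copula pi i j.+1
  + t * s * discrete_copula pi i.+1 j.+1.

Variables (d : measure_display) (T : measurableType d) (P : probability T R).

(* pi is a random element of 'S_k (with the discrete sigma-algebra) whose law
   under P is uniform. *)
Definition uniform_random_perm (pi : T -> 'S_k) : Prop :=
  forall p : 'S_k,
    measurable (pi @^-1` [set p]) /\
    P (pi @^-1` [set p]) = (#|{: 'S_k}|%:R^-1)%:E.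

Definition random_field (pi : T -> 'S_k) (u v : R) : T -> R :=
  fun w => checkerboard (pi w) u v.

End CheckerboardCopula.

(* Main.v *)
(* Writing a_m(u) for the fraction of the m-th mesh interval lying below u, the
   checkerboard copula is the linear permutation statistic
   k^-1 * sum_m a_m(u) * a_(pi m)(v).  Its mean follows from pi m being uniform.
   Centring both weight families at u and v centres the statistic, and its
   second moment is then that of Hoeffding's combinatorial sum: for m != n the
   mixed moments of (pi m, pi n) are all equal, so they are -1/(k-1) times the
   diagonal one, leaving the product of the sums of squares of the centred
   weights. *)
Require Import Defs.
From HB Require Import structures.
From mathcomp Require Import all_boot all_order all_algebra all_fingroup.
From mathcomp Require Import all_classical all_reals all_analysis.
From mathcomp Require Import ring.

Set Implicit Arguments.
Unset Strict Implicit.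
Unset Printing Implicit Defensive.

Import Order.TTheory GRing.Theory Num.Theory.
Local Open Scope classical_set_scope.
Local Open Scope ring_scope.

Section PermutationSums.
Variables (F : numFieldType) (I : finType).
Implicit Types (a b g : I -> F) (m n : I).

Lemma sum_app_perm g (p : {perm I}) : \sum_x g (p x) = \sum_x g x.
Proof. by rewrite [RHS](reindex_perm p). Qed.

(** Left multiplication by [tperm m n] is a bijection of the group that turns the value at [m] into
    the value at [n]. *)
Lemma sum_perm_app g m n :
  \sum_(p : {perm I}) g (p m) = \sum_(p : {perm I}) g (p n).
Proof.
rewrite (reindex_inj (mulgI (tperm m n))).
by apply: eq_bigr => p _; rewrite permM tpermL.
Qed.

(** Double counting: the sum is the same at all [#|I|] points, and each single [p] runs once through
    all values of [g]. *)
Lemma sum_perm_app_mean g m :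
  #|I|%:R * \sum_(p : {perm I}) g (p m) = #|{perm I}|%:R * \sum_x g x.
Proof.
rewrite mulr_natl -sumr_const (eq_bigr _ (fun n _ => sum_perm_app g m n)).
rewrite exchange_big mulr_natl -sumr_const.
by apply: eq_bigr => p _; rewrite sum_app_perm.
Qed.

(* The mixed moment does not depend on [n], and summing it over all [n],
   including [n = m], gives [0]. *)
Lemma sum_perm_app2 b m n : \sum_x b x = 0 -> m != n ->
  (#|I|%:R - 1) * \sum_(p : {perm I}) b (p m) * b (p n) =
  - \sum_(p : {perm I}) b (p m) ^+ 2.
Proof.
move=> b0 neq_mn; set c := \sum_p _ * _.
have cE n' : n' != m -> \sum_(p : {perm I}) b (p m) * b (p n') = c.
  (* This transposition fixes [m], as both [n] and [n'] differ from it. *)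
  move=> neq_n'm; rewrite (reindex_inj (mulgI (tperm n n'))).
  by apply: eq_bigr => p _; rewrite !permM tpermR tpermD // eq_sym.
have : \sum_n' \sum_(p : {perm I}) b (p m) * b (p n') = 0.
  rewrite exchange_big big1 // => p _; rewrite -mulr_sumr.
  by rewrite sum_app_perm b0 mulr0.
rewrite (bigD1 m) //= (eq_bigr _ cE) sumr_const.
have -> : \sum_(p : {perm I}) b (p m) * b (p m) =
    \sum_(p : {perm I}) b (p m) ^+ 2 by [].
have -> : #|[pred n' | n' != m]| = (#|I| - 1)%N by rewrite subn1 -(cardC1 m).
have I0 : (0 < #|I|)%N by apply/card_gt0P; exists m.
rewrite -[c *+ _]mulr_natl (natrB _ I0) addrC => /eqP; rewrite addr_eq0 => /eqP.
exact.
Qed.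

(** Expand the square row by row. As [a] sums to 0, the off-diagonal weights of row [m] add up to
    [- a m ^+ 2], so the row carries the factor 1/n + 1/(n(n-1)) = 1/(n-1), where n is [#|I|]. *)
Lemma sum_perm_stat_sqr a b : (1 < #|I|)%N ->
  \sum_m a m = 0 -> \sum_x b x = 0 ->
  \sum_(p : {perm I}) (\sum_m a m * b (p m)) ^+ 2 =
  #|{perm I}|%:R / (#|I|%:R - 1)
    * (\sum_m a m ^+ 2) * (\sum_x b x ^+ 2).
Proof.
move=> I1 a0 b0.
have n0 : #|I|%:R != 0 :> F by rewrite pnatr_eq0 -lt0n (ltn_trans _ I1).
have n1 : #|I|%:R - 1 != 0 :> F by rewrite subr_eq0 pnatr_eq1 gtn_eqF.
set B := \sum_x b x ^+ 2; set N : F := #|{perm I}|%:R.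
have diag m : \sum_(p : {perm I}) b (p m) ^+ 2 = N * B / #|I|%:R.
  by rewrite -(sum_perm_app_mean (fun x => b x ^+ 2) m) mulrAC mulfV // mul1r.
have offdiag m n : n != m ->
    \sum_(p : {perm I}) b (p m) * b (p n)
    = - (N * B / #|I|%:R / (#|I|%:R - 1)).
  move=> nm; apply: (mulfI n1); rewrite sum_perm_app2 1?eq_sym // diag.
  by field; rewrite n0 n1.
transitivity (\sum_m a m * \sum_n a n * \sum_(p : {perm I}) b (p m) * b (p n)).
  under eq_bigr => p _ do rewrite expr2 mulr_suml.
  rewrite exchange_big; apply: eq_bigr => m _.
  under eq_bigr => p _ do rewrite mulr_sumr.
  rewrite exchange_big mulr_sumr; apply: eq_bigr => n _.
  by rewrite !mulr_sumr; apply: eq_bigr => p _; ring.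
rewrite mulrAC mulr_sumr; apply: eq_bigr => m _.
have an : \sum_(n | n != m) a n = - a m.
  by apply/eqP; rewrite -addr_eq0 addrC; have /eqP := a0; rewrite (bigD1 m).
rewrite (bigD1 m) //= (eq_bigr (fun n => a n *
    - (N * B / #|I|%:R / (#|I|%:R - 1)))); last first.
  by move=> n nm; rewrite offdiag.
rewrite -mulr_suml an.
under eq_bigr => p _ do rewrite -expr2.
by rewrite diag; field; rewrite n0 n1.
Qed.

End PermutationSums.

Section CellWeight.
Variable R : realFieldType.
Implicit Types (t : R) (i k m : nat).

(* With [x = (i + t) / k], this is the fraction of [[m/k, (m+1)/k]] lying
   below [x]. *)
Definition cell_weight i t m : R := (m < i)%:R + t * (m == i)%:R.

(** This is linear interpolation between the nodes [i] and [i.+1]; a product of two such weights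
    expands into the four corner terms of [checkerboard]. *)
Lemma cell_weightE i t m :
  cell_weight i t m = (1 - t) * (m < i)%:R + t * (m < i.+1)%:R.
Proof. by rewrite /cell_weight ltnS; case: ltngtP => _ /=; ring. Qed.

(** Every weight other than the one at [m = i] is 0 or 1, hence idempotent. *)
Lemma cell_weight_sqr i t m : cell_weight i t m ^+ 2 = cell_weight i (t ^+ 2) m.
Proof. by rewrite /cell_weight; case: ltngtP => _ /=; ring. Qed.

(** When [i = k] there is no cell of index [i] to carry the weight [t]. *)
Lemma sum_cell_weight k i t : (i <= k)%N -> (i = k -> t = 0) ->
  \sum_(m < k) cell_weight i t m = i%:R + t.
Proof.
move=> ik tk; rewrite big_split /= -mulr_sumr; congr (_ + _).
  rewrite -[i in RHS]card_ord -sumr_const (big_ord_widen _ (fun=> 1) ik).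
  by rewrite [RHS]big_mkcond; apply: eq_bigr => m _; case: ifP.
move: ik; rewrite leq_eqVlt => /predU1P[/tk -> |ik]; first by rewrite mul0r.
rewrite (bigD1 (Ordinal ik)) //= eqxx big1 ?addr0 ?mulr1 // => m /negbTE.
by rewrite -val_eqE /= => ->.
Qed.

Lemma sum_cell_weight_sqr k i t : (i <= k)%N -> (i = k -> t = 0) ->
  \sum_(m < k) cell_weight i t m ^+ 2 = i%:R + t ^+ 2.
Proof.
move=> ik tk; under eq_bigr => m _ do rewrite cell_weight_sqr.
by apply: sum_cell_weight => // /tk ->; rewrite expr0n.
Qed.

End CellWeight.

Section Checkerboard.
Variables (R : realType) (k : nat).
Implicit Types (p : 'S_k) (i j : nat) (u v t s : R).

Lemma discrete_copulaE p i j : (i <= k)%N -> (j <= k)%N ->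
  discrete_copula R p i j = k%:R^-1 * \sum_(m < k) (m < i)%:R * (p m < j)%:R.
Proof.
move=> ik jk; rewrite /discrete_copula ik jk; congr (_ * _).
rewrite cardsE -sum1_card natr_sum big_mkcond /=.
by apply: eq_bigr => m _; rewrite -natrM mulnb unfold_in; case: ifP.
Qed.

Lemma checkerboardE p u v i j t s :
  Num.truncn (u * k%:R) = i -> Num.truncn (v * k%:R) = j ->
  t = u * k%:R - i%:R -> s = v * k%:R - j%:R ->
  (i <= k)%N -> (j <= k)%N -> (i = k -> t = 0) -> (j = k -> s = 0) ->
  checkerboard p u v
  = k%:R^-1 * \sum_(m < k) cell_weight i t m * cell_weight j s (p m).
Proof.
move=> iE jE tE sE ik jk tk sk.
rewrite /checkerboard iE jE -tE -sE.
(* Off the grid [discrete_copula] defaults to 0, unlike the counting sum; the two agree there only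
   because the coefficient [x] vanishes. *)
have scaledE x i' j' : x = 0 \/ (i' <= k)%N && (j' <= k)%N ->
    x * discrete_copula R p i' j'
    = k%:R^-1 * \sum_(m < k) x * ((m < i')%:R * (p m < j')%:R).
  case=> [->|/andP[? ?]]; rewrite -mulr_sumr ?mul0r ?mulr0 //.
  by rewrite discrete_copulaE // mulrCA.
have ti : t = 0 \/ (i < k)%N.
  by move: ik; rewrite leq_eqVlt => /predU1P[/tk|]; [left|right].
have sj : s = 0 \/ (j < k)%N.
  by move: jk; rewrite leq_eqVlt => /predU1P[/sk|]; [left|right].
have c00 : (1 - t) * (1 - s) = 0 \/ (i <= k)%N && (j <= k)%N.
  by rewrite ik jk; right.
have c10 : t * (1 - s) = 0 \/ (i < k)%N && (j <= k)%N.
  by case: ti => ->; rewrite ?mul0r ?jk; [left|right].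
have c01 : (1 - t) * s = 0 \/ (i <= k)%N && (j < k)%N.
  by case: sj => ->; rewrite ?mulr0 ?ik; [left|right].
have c11 : t * s = 0 \/ (i < k)%N && (j < k)%N.
  case: ti => ->; first by rewrite mul0r; left.
  by case: sj => ->; rewrite ?mulr0; [left|right].
rewrite (scaledE _ _ _ c00) (scaledE _ _ _ c10) (scaledE _ _ _ c01).
rewrite (scaledE _ _ _ c11).
rewrite -!mulrDr -!big_split; congr (_ * _).
by apply: eq_bigr => m _ /=; rewrite !cell_weightE; ring.
Qed.

End Checkerboard.

(** The composite is a finite combination of indicators of the fibres of [pi], which all have the
    same probability. *)
Lemma expectation_uniform_perm (R : realType) (d : measure_display)
    (T : measurableType d) (P : probability T R) (k : nat) (pi : T -> 'S_k)
    (f : 'S_k -> R) : uniform_random_perm P pi ->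
  'E_P[f \o pi]%E = (#|{: 'S_k}|%:R^-1 * \sum_p f p)%:E.
Proof.
move=> hpi; rewrite unlock.
transitivity (\int[P]_w \sum_p ((f p)%:E * (\1_(pi @^-1` [set p]) w)%:E))%E.
  apply: eq_integral => w _ /=.
  rewrite (bigD1 (pi w)) //= big1 ?adde0; last first.
    move=> p pw; rewrite indicE memNset ?mule0 // => /= wp.
    by rewrite wp eqxx in pw.
  by rewrite indicE mem_set // mule1.
rewrite integral_sum //=; last first.
  by move=> p; apply: integrableZl => //; apply: integrable_indic; case: (hpi p).
rewrite mulr_sumr -sumEFin.
apply: eq_bigr => p _; have [mp Pp] := hpi p.
rewrite integralZl //; last exact: integrable_indic.
by rewrite integral_indic // setIT [X in (_ * X)%E]Pp -EFinM mulrC.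
Qed.

Lemma truncn_frac (R : realType) (k i : nat) (u t : R) :
  0 <= u <= 1 -> Num.floor (u * k%:R) = i%:Z -> t = u * k%:R - i%:R ->
  [/\ Num.truncn (u * k%:R) = i, (i <= k)%N & i = k -> t = 0].
Proof.
move=> /andP[u0 u1] iE tE.
have uk0 : 0 <= u * k%:R by rewrite mulr_ge0.
have le_iu : i%:R <= u * k%:R.
  by have := floor_le (u * k%:R); rewrite iE.
have uk : u * k%:R <= k%:R by rewrite ler_piMl.
split.
- by rewrite truncn_floor uk0 iE.
- by rewrite -(ler_nat R) (le_trans le_iu).
- by move=> ik; apply/eqP; rewrite tE subr_eq0 eq_le le_iu ik uk.
Qed.

Theorem theorem5p1 (R : realType) (d : measure_display) (T : measurableType d)
    (P : probability T R) (k : nat) (hk : (2 <= k)%N)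
    (pi : T -> 'S_k) (hpi : uniform_random_perm P pi)
    (u v : R) (hu : 0 <= u <= 1) (hv : 0 <= v <= 1)
    (i j : nat) (t s : R)
    (hi : Num.floor (u * k%:R) = i%:Z) (hj : Num.floor (v * k%:R) = j%:Z)
    (ht : t = u * k%:R - i%:R) (hs : s = v * k%:R - j%:R) :
  ('E_P[random_field pi u v] = (u * v)%:E)%E /\
  ('V_P[random_field pi u v] =
    (((k%:R - 1)^-1 * (u * (1 - u) - t * (1 - t) / k%:R)
                    * (v * (1 - v) - s * (1 - s) / k%:R))%R)%:E)%E.
Proof.
have k0 : (0 < k)%N by apply: ltn_trans hk.
have kn0 : k%:R != 0 :> R by rewrite pnatr_eq0 -lt0n.
have kn1 : k%:R - 1 != 0 :> R by rewrite subr_eq0 pnatr_eq1 gtn_eqF.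
have N0 : #|{: 'S_k}|%:R != 0 :> R.
  by rewrite pnatr_eq0 -lt0n; apply/card_gt0P; exists 1%g.
have [iE ik tk] := truncn_frac hu hi ht.
have [jE jk sk] := truncn_frac hv hj hs.
pose a (m : 'I_k) : R := cell_weight i t m.
pose b (m : 'I_k) : R := cell_weight j s m.
have sum_a : \sum_m a m = k%:R * u by rewrite sum_cell_weight // ht; ring.
have sum_b : \sum_m b m = k%:R * v by rewrite sum_cell_weight // hs; ring.
have fieldE : random_field pi u v
    = (fun p : 'S_k => k%:R^-1 * \sum_m a m * b (p m)) \o pi.
  by apply/funext => w; exact: checkerboardE.
have meanE : ('E_P[random_field pi u v] = (u * v)%:E)%E.
  rewrite fieldE expectation_uniform_perm //; congr _%:E.
  rewrite -mulr_sumr exchange_big /=.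
  under eq_bigr => m _ do rewrite -mulr_sumr.
  have bE m : \sum_(p : 'S_k) b (p m) = #|{: 'S_k}|%:R * v.
    apply: (mulfI kn0).
    by have := sum_perm_app_mean b m; rewrite card_ord sum_b => ->; ring.
  under eq_bigr => m _ do rewrite bE.
  by rewrite -mulr_suml sum_a; field; rewrite kn0.
split=> //; rewrite /variance unlock meanE /=.
pose a' m := a m - u; pose b' m := b m - v.
have sum_a' : \sum_m a' m = 0.
  by rewrite sumrB sum_a sumr_const card_ord mulr_natl subrr.
have sum_b' : \sum_m b' m = 0.
  by rewrite sumrB sum_b sumr_const card_ord mulr_natl subrr.
have sqr_a' : \sum_m a' m ^+ 2 = k%:R * (u * (1 - u) - t * (1 - t) / k%:R).
  transitivity (\sum_m (a m ^+ 2 - (u *+ 2) * a m + u ^+ 2)).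
    by apply: eq_bigr => m _; rewrite /a'; ring.
  rewrite big_split /= sumrB -mulr_sumr sum_a sumr_const card_ord
    -[u ^+ 2 *+ k]mulr_natl.
  rewrite sum_cell_weight_sqr //.
  (* Hence [i%:R + t ^+ 2] is [u * k%:R - t * (1 - t)], the source of the correction term in the
     variance. *)
  have -> : i%:R = u * k%:R - t by rewrite ht; ring.
  by field.
have sqr_b' : \sum_m b' m ^+ 2 = k%:R * (v * (1 - v) - s * (1 - s) / k%:R).
  transitivity (\sum_m (b m ^+ 2 - (v *+ 2) * b m + v ^+ 2)).
    by apply: eq_bigr => m _; rewrite /b'; ring.
  rewrite big_split /= sumrB -mulr_sumr sum_b sumr_const card_ord
    -[v ^+ 2 *+ k]mulr_natl.
  rewrite sum_cell_weight_sqr //.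
  have -> : j%:R = v * k%:R - s by rewrite hs; ring.
  by field.
have centeredE : ((random_field pi u v \- cst (u * v))
      * (random_field pi u v \- cst (u * v)))%R
    = (fun p : 'S_k => k%:R^-1 ^+ 2 * (\sum_m a' m * b' (p m)) ^+ 2) \o pi.
  rewrite fieldE; apply/funext => w /=; rewrite -expr2 -exprMn; congr (_ ^+ 2).
  (* Of the three sums, the second is [k%:R * u * v] and the third vanishes, since a permutation
     only rearranges the terms of [b']. *)
  transitivity (k%:R^-1 * \sum_m (a m * b (pi w m) - a m * v - u * b' (pi w m))).
    rewrite !sumrB -mulr_suml -mulr_sumr sum_a.
    by rewrite sum_app_perm sum_b' mulr0 subr0 mulrBr -mulrA mulKf.
  by congr (_ * _); apply: eq_bigr => m _; rewrite /a' /b'; ring.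
rewrite centeredE expectation_uniform_perm //; congr _%:E.
(* The two factors [k%:R] from the sums of squares cancel [k%:R^-1 ^+ 2], and the number of
   permutations cancels too. *)
rewrite -mulr_sumr sum_perm_stat_sqr ?card_ord // sqr_a' sqr_b'.
by field; rewrite kn0 kn1 N0.
Qed.
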